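(* The constrained rewrite system CANON without rule T1.7 (that is, the system consisting of all rules A1.1--A1.9.6, T1.1--T1.6 and T2.1--T2.6 listed in the context) and the constrained rewrite system SIMP (rules S1--S4 listed in the context) are terminating. That is, for each of these two systems $R$ there is no infinite sequence of one-step rewrites $t\to_R t_1\to_R t_2\to_R\cdots$, for any term $t$.
   Context: **Terms.** The signature $\Sigma$ consists of the binary function symbols $+,\times,\wedge$ (exponentiation), $/$ (division), the unary function symbols $\sin,\cos$, a unary function symbol ''quote'', the constant $\pi$, and all integer and finite decimal number constants. The rules below additionally use auxiliary binary symbols $\mathrm{pwr\_n},\mathrm{sin\_n},\mathrm{cos\_n}$ and a unary symbol $\mathrm s$. $\Pi=\{p_1,\dots,p_n\}$ is a finite set (left unspecified) of additional constants called parameters, and $V$ is a denumerable set of variables. Terms are the first-order terms over these symbols and variables. $[\![t]\!]$ abbreviates $\mathrm{quote}(t)$; such a term is called a quote-term and $t$ the quoted term. A term is quote-free if quote does not occur in it, and parameter-free if no parameter occurs in it. **Simplifier.** Let $\mathcal A$ be the algebra with the reals as carrier that interprets the arithmetic symbols as the expected functions over the reals. A simplifier is a total function $\mathit{simp}$ on quote-free and parameter-free terms such that (i) if $\mathit{simp}(t)=s$ then $t$ and $s$ have the same value in $\mathcal A$ under every assignment of reals to the variables; (ii) $\mathit{simp}(n)=n$ for every number $n$; (iii) if $t$ is ground then $\mathit{simp}(t)$ is a number. A simplifier $\mathit{simp}$ is fixed. It is extended to all terms by: $t{\downarrow_{\mathit{simp}}}=t$ if $t\in V$ or $t\in\Pi$;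 $[\![u]\!]{\downarrow_{\mathit{simp}}}=[\![\mathit{simp}(u)]\!]$; and otherwise $f(t_1,\dots,t_n){\downarrow_{\mathit{simp}}}=f(t_1{\downarrow_{\mathit{simp}}},\dots,t_n{\downarrow_{\mathit{simp}}})$. **Rules and rewriting.** A rule is $\rho=(l\to r\mid C)$; here the constraint $C$ is empty (and then not written) or a single ordering constraint $x\succ y$ between variables, evaluated with the ordering $\succ$ defined below. One-step rewriting (with simplification): $t\to_\rho s$ iff $t$ has, at some position $p$, a non-variable subterm $u$ with $u=l\delta$ for some substitution $\delta$ such that $C\delta$ holds, and $s$ is obtained from $t$ by replacing the subterm at $p$ by $(r\delta){\downarrow_{\mathit{simp}}}$. (It is a standing assumption that in the rule instances used the quoted terms are parameter-free and quote-free, so that $(r\delta){\downarrow_{\mathit{simp}}}$ is defined.) For a rewrite system $R$ (a finite set of rules), $t\to_R s$ iff $t\to_\rho s$ for some $\rho\in R$. **The ordering $\succ$.** It is a weighted path ordering. The weight $w$ of a term is an arithmetic expression over its variables: - $w(v)=v$ for $v\in V$; - $w(\mathrm{cos\_n}(n,x))=w(\mathrm{sin\_n}(n,x))=(2\cdot 2^{w(x)\cdot 3}+1)^{2\cdot w(n)}$; - $w(\mathrm{pwr\_n}(x,n))=(2^{w(n)}+1)^{w(x)}$; - $w(\mathrm s(n))=w(n)+1$; - $w(x\wedge y)=(w(x)\cdot w(x))\cdot(2\cdot w(y))$; - $w(x\times y)=2\cdot w(x)\cdot w(y)$; - $w(x+y)=1+w(x)+w(y)$; - $w(\sin(x))=w(\cos(x))=2^{w(x)\cdot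 3}$; - $w(p)=1$ for parameters $p\in\Pi$; - $w([\![t]\!])=w(t)=1$, where the quoted term $t$ (parameter-free and quote-free, for example a number) is regarded as a constant symbol. Write $s>_w t$ (resp. $s\ge_w t$) iff $w(s)>w(t)$ (resp. $w(s)\ge w(t)$) for all assignments of natural numbers $\ge 1$ to the variables. The precedence on symbols is $\sin>\cos>\wedge>\times>+>p_1>\cdots>p_n>\mathrm{quote}>t$ for every parameter-free and quote-free term $t$; these terms $t$ are regarded as constant symbols that are pairwise unrelated. The order of the $p_i$ is arbitrary but fixed. Then $s\succ t$ iff $s>_w t$, or $s\ge_w t$, $s=f(s_1,\dots,s_n)$ is not a variable, and one of the following holds: 1. $s_i\succ t$ or $s_i=t$ for some $i$; 2. $t=g(t_1,\dots,t_m)$ is not a variable, $s\succ t_j$ for all $j$, and either $f>g$ in the precedence, or $f=g$ and $(s_1,\dots,s_n)$ is greater than $(t_1,\dots,t_m)$ in the lexicographic extension of $\succ$, with arguments compared in the order given by the status of $f$. Here $=$ is syntactic equality. The status is left-to-right, except that for SIMP the symbol $\times$ has right-to-left status. **CANON** ($x,y,z,v,x_1,x_2,n,a,b$ are variables): - A1.1 $(x+y)+z\to x+(y+z)$ - A1.2.1 $x+y\to y+x\mid x\succ y$ - A1.2.2 $x+(y+z)\to y+(x+z)\mid x\succ y$ - A1.3.1 $[\![0]\!]+x\to x$ - A1.3.2 $[\![a]\!]+[\![b]\!]\to[\![a+b]\!]$ - A1.3.3 $[\![a]\!]+([\![b]\!]+z)\to[\![a+b]\!]+z$ - A1.3.4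 $([\![a]\!]\times x)+([\![b]\!]\times x)\to[\![a+b]\!]\times x$ - A1.3.5 $([\![a]\!]\times x)+(([\![b]\!]\times x)+z)\to([\![a+b]\!]\times x)+z$ - A1.4 $(x\times y)\times z\to x\times(y\times z)$ - A1.5.1 $x\times y\to y\times x\mid x\succ y$ - A1.5.2 $x\times(y\times z)\to y\times(x\times z)\mid x\succ y$ - A1.6.1 $[\![0]\!]\times x\to[\![0]\!]$ - A1.6.2 $[\![a]\!]\times[\![b]\!]\to[\![a\times b]\!]$ - A1.6.3 $[\![a]\!]\times([\![b]\!]\times z)\to[\![a\times b]\!]\times z$ - A1.7.1 $x\times(y+z)\to(x\times y)+(x\times z)$ - A1.7.2 $(y+z)\times x\to(y\times x)+(z\times x)$ - A1.8.1 $(x\wedge y)\wedge z\to x\wedge(y\times z)$ - A1.8.2 $(x\wedge y)\times(x\wedge z)\to x\wedge(y+z)$ - A1.8.3 $(x\wedge y)\times((x\wedge z)\times v)\to(x\wedge(y+z))\times v$ - A1.9.1 $[\![a]\!]\wedge[\![b]\!]\to[\![a\wedge b]\!]$ - A1.9.2 $\mathrm{pwr\_n}(x,[\![0]\!])\to[\![1]\!]$ - A1.9.3 $\mathrm{pwr\_n}(x,\mathrm s(n))\to x\times\mathrm{pwr\_n}(x,n)$ - A1.9.4 $(x+y)\wedge[\![1]\!]\to x+y$ - A1.9.5 $(x\times y)\wedge[\![a]\!]\to(x\wedge[\![a]\!])\times(y\wedge[\![a]\!])$ - A1.9.6 $x\wedge[\![0]\!]\to[\![1]\!]$ - T1.1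 $\sin([\![-1]\!]\times x)\to[\![-1]\!]\times\sin(x)$ - T1.2 $\cos([\![-1]\!]\times x)\to\cos(x)$ - T1.3 $\sin(x_1+x_2)\to(\sin(x_1)\times\cos(x_2))+(\cos(x_1)\times\sin(x_2))$ - T1.4 $\cos(x_1+x_2)\to(\cos(x_1)\times\cos(x_2))+([\![-1]\!]\times(\sin(x_1)\times\sin(x_2)))$ - T1.5 $\mathrm{cos\_n}(\mathrm s(\mathrm s(n)),x)\to([\![2]\!]\times(\cos(x)\times\mathrm{cos\_n}(\mathrm s(n),x)))+([\![-1]\!]\times\mathrm{cos\_n}(n,x))$ - T1.6 $\mathrm{sin\_n}(\mathrm s(\mathrm s(n)),x)\to([\![2]\!]\times(\cos(x)\times\mathrm{sin\_n}(\mathrm s(n),x)))+([\![-1]\!]\times\mathrm{sin\_n}(n,x))$ - T1.7 (omitted in the claim) $\sin(x)\wedge[\![2]\!]\to[\![1]\!]+([\![-1]\!]\times(\cos(x)\wedge[\![2]\!]))$ - T2.1 $\mathrm{cos\_n}(\mathrm s([\![0]\!]),x)\to\cos([\![1]\!]\times x)$ - T2.2 $\mathrm{cos\_n}([\![0]\!],x)\to\cos([\![0]\!])$ - T2.3 $\mathrm{sin\_n}(\mathrm s([\![0]\!]),x)\to\sin([\![1]\!]\times x)$ - T2.4 $\mathrm{sin\_n}([\![0]\!],x)\to\sin([\![0]\!])$ - T2.5 $\sin([\![x]\!])\to[\![\sin(x)]\!]$ - T2.6 $\cos([\![x]\!])\to[\![\cos(x)]\!]$ **SIMP**: - S1 $([\![a]\!]\times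 x)+([\![b]\!]\times y)\to([\![b]\!]\times y)+([\![a]\!]\times x)\mid x\succ y$ - S2 $([\![a]\!]\times x)+(([\![b]\!]\times y)+z)\to([\![b]\!]\times y)+(([\![a]\!]\times x)+z)\mid x\succ y$ - S3 $([\![a]\!]\times x)+([\![b]\!]\times x)\to[\![a+b]\!]\times x$ - S4 $([\![a]\!]\times x)+(([\![b]\!]\times x)+z)\to([\![a+b]\!]\times x)+z$ *)

(* Defs.v *)
From Stdlib Require Import Reals ZArith List Arith.
Import ListNotations.

Set Implicit Arguments.
Unset Strict Implicit.
Unset Printing Implicit Defensive.

(** * Terms *)

Inductive unary := Sin | Cos | Quote | Succ.

Inductive binary := Plus | Times | Pow | Div | PwrN | SinN | CosN.

(* First-order terms over a set [C] of constants; the set V of variables is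
   [nat]. *)
Inductive tm (C : Type) :=
| Var (x : nat)
| Cst (c : C)
| Un (f : unary) (t : tm C)
| Bin (f : binary) (s t : tm C).

Arguments Var {C} x.
Arguments Un {C} f t.
Arguments Bin {C} f s t.

(* Integer and finite decimal literals: [mantissa / 10 ^ scale]. *)
Record decimal := Dec { mantissa : Z; scale : nat }.

(* [Par i] is the parameter p_(i+1), for a signature with [np] parameters. *)
Definition parameter (np : nat) := {i : nat | (i <? np) = true}.

Inductive const (np : nat) :=
| Num (d : decimal)
| Pi
| Par (i : parameter np).

Arguments Num {np} d.
Arguments Pi {np}.

Definition term (np : nat) := tm (const np).

Fixpoint quote_free {C} (t : tm C) : bool :=
  match t with
  | Var _ | Cst _ => true
  | Un Quote _ => false
  | Un _ u => quote_free u
  | Bin _ u v => quote_free u && quote_free v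
  end.

Fixpoint parameter_free {np} (t : term np) : bool :=
  match t with
  | Cst (Par _) => false
  | Var _ | Cst _ => true
  | Un _ u => parameter_free u
  | Bin _ u v => parameter_free u && parameter_free v
  end.

Definition pure {np} (t : term np) : bool := quote_free t && parameter_free t.

Fixpoint ground {C} (t : tm C) : bool :=
  match t with
  | Var _ => false
  | Cst _ => true
  | Un _ u => ground u
  | Bin _ u v => ground u && ground v
  end.

Fixpoint quotes_pure {np} (t : term np) : bool :=
  match t with
  | Var _ | Cst _ => true
  | Un Quote u => pure u
  | Un _ u => quotes_pure u
  | Bin _ u v => quotes_pure u && quotes_pure v
  end.

(** * The real algebra and simplifiers *)

Record algebra (np : nat) := {
  un_op : unary -> R -> R;
  bin_op : binary -> R -> R -> R;
  par_val : parameter np -> R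
}.

(* Only the values of the arithmetic symbols that are defined over the reals
   are prescribed.  Division by zero, [0 ^ y] for [y <= 0], non-integer powers
   of negative numbers, and the non-arithmetic symbols are left open. *)
Record real_algebra {np} (A : algebra np) : Prop := {
  ra_plus : forall x y, bin_op A Plus x y = (x + y)%R;
  ra_times : forall x y, bin_op A Times x y = (x * y)%R;
  ra_div : forall x y, y <> 0%R -> bin_op A Div x y = (x / y)%R;
  ra_pow_pos : forall x y, (0 < x)%R -> bin_op A Pow x y = Rpower x y;
  ra_pow_zero : forall y, (0 < y)%R -> bin_op A Pow 0 y = 0%R;
  ra_pow_neg : forall x (z : Z),
    (x < 0)%R -> bin_op A Pow x (IZR z) = powerRZ x z;
  ra_sin : forall x, un_op A Sin x = sin x;
  ra_cos : forall x, un_op A Cos x = cos x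
}.

Definition dec_val (d : decimal) : R := (IZR (mantissa d) / 10 ^ scale d)%R.

Fixpoint eval {np} (A : algebra np) (a : nat -> R) (t : term np) : R :=
  match t with
  | Var x => a x
  | Cst (Num d) => dec_val d
  | Cst Pi => PI
  | Cst (Par i) => par_val A i
  | Un f u => un_op A f (eval A a u)
  | Bin f u v => bin_op A f (eval A a u) (eval A a v)
  end.

Definition representable {np} (A : algebra np) (t : term np) : Prop :=
  exists d, forall a, eval A a t = dec_val d.

(* A simplifier is a function on pure terms; its values elsewhere are
   irrelevant.  No function can both preserve all values and map every ground
   term to a literal (1/3 and pi have no finite decimal expansion), so values
   have to be preserved except on ground terms whose value no literal
   denotes; on these any literal, e.g. an approximation, may be returned. *)
Record simplifier {np} (A : algebra np) (simp : term np -> term np) : Prop := {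
  simp_pure : forall t, pure t = true -> pure (simp t) = true;
  simp_value : forall t, pure t = true ->
    (ground t = true -> representable A t) ->
    forall a, eval A a (simp t) = eval A a t;
  simp_num : forall d, simp (Cst (Num d)) = Cst (Num d);
  simp_ground : forall t, pure t = true -> ground t = true ->
    exists d, simp t = Cst (Num d)
}.

Fixpoint normalize {np} (simp : term np -> term np) (t : term np) : term np :=
  match t with
  | Var _ | Cst _ => t
  | Un Quote u => Un Quote (simp u)
  | Un f u => Un f (normalize simp u)
  | Bin f u v => Bin f (normalize simp u) (normalize simp v)
  end.

(** * The ordering *)

(* For the ordering, a pure term below [Quote] is a constant symbol [OTerm t];
   the unquoted literals and pi are the same constant symbols. *)
Inductive oconst (np : nat) :=
| OPar (i : parameter np)
| OTerm (t : term np).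

Definition oterm (np : nat) := tm (oconst np).

Fixpoint to_oterm {np} (t : term np) : oterm np :=
  match t with
  | Var x => Var x
  | Cst (Par i) => Cst (OPar i)
  | Cst c => Cst (OTerm (Cst c))
  | Un Quote u => Un Quote (Cst (OTerm u))
  | Un f u => Un f (to_oterm u)
  | Bin f u v => Bin f (to_oterm u) (to_oterm v)
  end.

Definition omap1 (f : nat -> nat) (x : option nat) : option nat :=
  match x with Some m => Some (f m) | None => None end.

Definition omap2 (f : nat -> nat -> nat) (x y : option nat) : option nat :=
  match x, y with Some m, Some k => Some (f m k) | _, _ => None end.

(* Division has no weight: a term in which it occurs (outside quotes) is
   incomparable with every term. *)
Fixpoint weight {np} (a : nat -> nat) (t : oterm np) : option nat :=
  match t with
  | Var v => Some (a v)
  | Cst _ => Some 1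
  | Un f x =>
      match f with
      | Sin | Cos => omap1 (fun x => 2 ^ (x * 3)) (weight a x)
      | Quote => Some 1
      | Succ => omap1 (fun n => n + 1) (weight a x)
      end
  | Bin f x y =>
      match f with
      | Plus => omap2 (fun x y => 1 + x + y) (weight a x) (weight a y)
      | Times => omap2 (fun x y => 2 * x * y) (weight a x) (weight a y)
      | Pow => omap2 (fun x y => (x * x) * (2 * y)) (weight a x) (weight a y)
      | Div => None
      | PwrN => omap2 (fun x n => (2 ^ n + 1) ^ x) (weight a x) (weight a y)
      | SinN | CosN =>
          omap2 (fun n x => (2 * 2 ^ (x * 3) + 1) ^ (2 * n))
                (weight a x) (weight a y)
      end
  end.

Definition weight_gt {np} (s t : oterm np) : Prop :=
  forall a, (forall x, 1 <= a x) ->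
  exists m k, weight a s = Some m /\ weight a t = Some k /\ k < m.

Definition weight_ge {np} (s t : oterm np) : Prop :=
  forall a, (forall x, 1 <= a x) ->
  exists m k, weight a s = Some m /\ weight a t = Some k /\ k <= m.

Inductive symbol (np : nat) :=
| SCst (c : oconst np)
| SUn (f : unary)
| SBin (f : binary).

Arguments SUn {np} f.
Arguments SBin {np} f.

Definition head {np} (t : oterm np) : option (symbol np) :=
  match t with
  | Var _ => None
  | Cst c => Some (SCst c)
  | Un f _ => Some (SUn f)
  | Bin f _ _ => Some (SBin f)
  end.

Definition args {C} (t : tm C) : list (tm C) :=
  match t with
  | Var _ | Cst _ => []
  | Un _ u => [u]
  | Bin _ u v => [u; v]
  end.

(* sin > cos > ^ > * > + > parameters > quote > quoted terms; the remaining
   symbols do not take part in the precedence. *)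
Definition level {np} (f : symbol np) : option nat :=
  match f with
  | SUn Sin => Some 7
  | SUn Cos => Some 6
  | SBin Pow => Some 5
  | SBin Times => Some 4
  | SBin Plus => Some 3
  | SCst (OPar _) => Some 2
  | SUn Quote => Some 1
  | SCst (OTerm _) => Some 0
  | _ => None
  end.

Inductive prec {np} : symbol np -> symbol np -> Prop :=
| prec_level f g i j : level f = Some i -> level g = Some j -> j < i -> prec f g
| prec_par i j :
    proj1_sig i < proj1_sig j ->
    prec (SCst (OPar i)) (SCst (OPar j)).

Inductive direction := LeftToRight | RightToLeft.

Definition status_args {np} (st : binary -> direction) (t : oterm np) :
    list (oterm np) :=
  match t with
  | Bin f _ _ => match st f with
                 | LeftToRight => args t
                 | RightToLeft => rev (args t)
                 end
  | _ => args t
  end.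

Inductive wpo {np} (st : binary -> direction) : oterm np -> oterm np -> Prop :=
| wpo_weight s t : weight_gt s t -> wpo st s t
| wpo_arg_gt s t si :
    weight_ge s t -> In si (args s) -> wpo st si t -> wpo st s t
| wpo_arg_eq s t :
    weight_ge s t -> In t (args s) -> wpo st s t
| wpo_prec s t f g :
    weight_ge s t -> head s = Some f -> head t = Some g ->
    (forall tj, In tj (args t) -> wpo st s tj) ->
    prec f g -> wpo st s t
| wpo_lex s t f l a b l1 l2 :
    weight_ge s t -> head s = Some f -> head t = Some f ->
    (forall tj, In tj (args t) -> wpo st s tj) ->
    status_args st s = l ++ a :: l1 -> status_args st t = l ++ b :: l2 ->
    wpo st a b -> wpo st s t.

Definition succ_ord {np} (st : binary -> direction) (s t : term np) : Prop :=
  wpo st (to_oterm s) (to_oterm t).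

(** * Constrained rewriting with simplification *)

(* [guard = Some (x, y)] is the constraint that the variable [x] be greater
   than the variable [y]. *)
Record rule (np : nat) := Rule {
  lhs : term np;
  rhs : term np;
  guard : option (nat * nat)
}.

Fixpoint subst {np} (d : nat -> term np) (t : term np) : term np :=
  match t with
  | Var x => d x
  | Cst c => Cst c
  | Un f u => Un f (subst d u)
  | Bin f u v => Bin f (subst d u) (subst d v)
  end.

Definition guard_holds {np} (st : binary -> direction) (d : nat -> term np)
    (c : option (nat * nat)) : Prop :=
  match c with
  | None => True
  | Some (x, y) => succ_ord st (d x) (d y)
  end.

Definition position := list nat.

Fixpoint subterm_at {C} (t : tm C) (p : position) : option (tm C) :=
  match p with
  | [] => Some t
  | i :: q => match nth_error (args t) i with
              | Some u => subterm_at u q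
              | None => None
              end
  end.

Fixpoint replace_at {C} (t : tm C) (p : position) (s : tm C) : tm C :=
  match p, t with
  | [], _ => s
  | 0 :: q, Un f u => Un f (replace_at u q s)
  | 0 :: q, Bin f u v => Bin f (replace_at u q s) v
  | 1 :: q, Bin f u v => Bin f u (replace_at v q s)
  | _, _ => t
  end.

(* The normal form of [subst d (rhs rho)] is defined when its quoted terms are
   pure.  Positions below [Quote] are not excluded. *)
Definition rule_step {np} (simp : term np -> term np)
    (st : binary -> direction) (rho : rule np) (t s : term np) : Prop :=
  exists (p : position) (u : term np) (d : nat -> term np),
    subterm_at t p = Some u /\
    (forall x, u <> Var x) /\
    u = subst d (lhs rho) /\
    guard_holds st d (guard rho) /\
    quotes_pure (subst d (rhs rho)) = true /\
    s = replace_at t p (normalize simp (subst d (rhs rho))).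

Definition rewrite_step {np} (simp : term np -> term np)
    (st : binary -> direction) (sys : list (rule np)) (t s : term np) : Prop :=
  exists rho, In rho sys /\ rule_step simp st rho t s.

Definition terminating {np} (step : term np -> term np -> Prop) : Prop :=
  forall t, ~ exists f : nat -> term np,
    f 0 = t /\ forall k, step (f k) (f (S k)).

(** * The rewrite systems *)

Declare Scope term_scope.
Delimit Scope term_scope with term.
Bind Scope term_scope with tm.
Bind Scope term_scope with term.

Notation "s + t" := (Bin Plus s t) : term_scope.
Notation "s * t" := (Bin Times s t) : term_scope.
Notation "s ^ t" := (Bin Pow s t) : term_scope.
Notation "⟦ t ⟧" := (Un Quote t%term) (at level 0, t at level 99) : term_scope.
Local Notation "l '-->' r" := (Rule l%term r%term None)
  (at level 80, r at level 60).
Local Notation "l '-->' r 'when' x '>>' y" := (Rule l%term r%term (Some (x, y)))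
  (at level 80, r at level 60, x at level 0, y at level 0).

Section Systems.

Variable np : nat.

Local Notation x := 0 (only parsing).
Local Notation y := 1 (only parsing).
Local Notation X := (Var x).
Local Notation Y := (Var y).
Local Notation Z := (Var 2).
Local Notation V := (Var 3).
Local Notation X1 := (Var 4).
Local Notation X2 := (Var 5).
Local Notation N := (Var 6).
Local Notation A := (Var 7).
Local Notation B := (Var 8).

Local Notation num z := (Cst (Num (Dec z%Z 0))).
Local Notation sin := (Un Sin).
Local Notation cos := (Un Cos).
Local Notation s := (Un Succ).
Local Notation pwr_n := (Bin PwrN).
Local Notation sin_n := (Bin SinN).
Local Notation cos_n := (Bin CosN).

Definition arithmetic_rules : list (rule np) := [
  (X + Y) + Z --> X + (Y + Z);
  X + Y --> Y + X when x >> y;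
  X + (Y + Z) --> Y + (X + Z) when x >> y;
  ⟦num 0⟧ + X --> X;
  ⟦A⟧ + ⟦B⟧ --> ⟦A + B⟧;
  ⟦A⟧ + (⟦B⟧ + Z) --> ⟦A + B⟧ + Z;
  (⟦A⟧ * X) + (⟦B⟧ * X) --> ⟦A + B⟧ * X;
  (⟦A⟧ * X) + ((⟦B⟧ * X) + Z) --> (⟦A + B⟧ * X) + Z;
  (X * Y) * Z --> X * (Y * Z);
  X * Y --> Y * X when x >> y;
  X * (Y * Z) --> Y * (X * Z) when x >> y;
  ⟦num 0⟧ * X --> ⟦num 0⟧;
  ⟦A⟧ * ⟦B⟧ --> ⟦A * B⟧;
  ⟦A⟧ * (⟦B⟧ * Z) --> ⟦A * B⟧ * Z;
  X * (Y + Z) --> (X * Y) + (X * Z);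
  (Y + Z) * X --> (Y * X) + (Z * X);
  (X ^ Y) ^ Z --> X ^ (Y * Z);
  (X ^ Y) * (X ^ Z) --> X ^ (Y + Z);
  (X ^ Y) * ((X ^ Z) * V) --> (X ^ (Y + Z)) * V;
  ⟦A⟧ ^ ⟦B⟧ --> ⟦A ^ B⟧;
  pwr_n X ⟦num 0⟧ --> ⟦num 1⟧;
  pwr_n X (s N) --> X * pwr_n X N;
  (X + Y) ^ ⟦num 1⟧ --> X + Y;
  (X * Y) ^ ⟦A⟧ --> (X ^ ⟦A⟧) * (Y ^ ⟦A⟧);
  X ^ ⟦num 0⟧ --> ⟦num 1⟧
].

Definition trigonometric_rules : list (rule np) := [
  sin (⟦num (-1)⟧ * X) --> ⟦num (-1)⟧ * sin X;
  cos (⟦num (-1)⟧ * X) --> cos X;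
  sin (X1 + X2) --> (sin X1 * cos X2) + (cos X1 * sin X2);
  cos (X1 + X2) --> (cos X1 * cos X2) + (⟦num (-1)⟧ * (sin X1 * sin X2));
  cos_n (s (s N)) X -->
    (⟦num 2⟧ * (cos X * cos_n (s N) X)) + (⟦num (-1)⟧ * cos_n N X);
  sin_n (s (s N)) X -->
    (⟦num 2⟧ * (cos X * sin_n (s N) X)) + (⟦num (-1)⟧ * sin_n N X)
].

Definition evaluation_rules : list (rule np) := [
  cos_n (s ⟦num 0⟧) X --> cos (⟦num 1⟧ * X);
  cos_n ⟦num 0⟧ X --> cos ⟦num 0⟧;
  sin_n (s ⟦num 0⟧) X --> sin (⟦num 1⟧ * X);
  sin_n ⟦num 0⟧ X --> sin ⟦num 0⟧;
  sin ⟦X⟧ --> ⟦sin X⟧;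
  cos ⟦X⟧ --> ⟦cos X⟧
].

(* Does not contain sin(x)^[2] -> [1] + [-1] * cos(x)^[2]. *)
Definition canon_without_sin_square : list (rule np) :=
  arithmetic_rules ++ trigonometric_rules ++ evaluation_rules.

Definition simp_system : list (rule np) := [
  (⟦A⟧ * X) + (⟦B⟧ * Y) --> (⟦B⟧ * Y) + (⟦A⟧ * X) when x >> y;
  (⟦A⟧ * X) + ((⟦B⟧ * Y) + Z) --> (⟦B⟧ * Y) + ((⟦A⟧ * X) + Z) when x >> y;
  (⟦A⟧ * X) + (⟦B⟧ * X) --> ⟦A + B⟧ * X;
  (⟦A⟧ * X) + ((⟦B⟧ * X) + Z) --> (⟦A + B⟧ * X) + Z
].

End Systems.

Definition canon_status (f : binary) : direction := LeftToRight.

Definition simp_status (f : binary) : direction :=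
  match f with Times => RightToLeft | _ => LeftToRight end.

(* Main.v *)
(** Quotes are opaque: the ordering sees a quoted term only up to equality, so all
    quoted terms may be merged into one constant (the [shape] of a term).
    Normalization and steps below a quote leave the shape unchanged, and every
    other step decreases it in the lexicographic product of two well-founded,
    context-closed relations.  The first is a strictly monotone interpretation
    [mass], which strictly decreases under every rule except associativity and the
    ordered swaps, where it is invariant.  The second is a weighted path ordering
    [path_gt] that contains the paper's and orients those remaining rules.  The
    paper's ordering alone is not enough: for x of weight 1 its weight increases
    along pwr_n(x, s(n)) -> x * pwr_n(x, n), and terms with a division are
    incomparable.

    Steps below quotes are handled by well-founded induction on the list of
    outermost quoted terms, in two stages.  If these are all constants, the same
    holds after any step, because a simplified ground term is a literal; this
    covers pure terms.  In general a step outside quotes only creates pure quoted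
    terms, so structural induction applies. *)

From Stdlib Require Import List Arith Lia.
Require Import Defs.
Import ListNotations.

(** * Weights at the all-ones assignment *)

Lemma args_ind {C} (P : tm C -> Prop) :
  (forall t, (forall u, In u (args t) -> P u) -> P t) -> forall t, P t.
Proof.
  intros H; induction t; apply H; simpl; intros w Hw;
    intuition (subst; assumption).
Qed.

Lemma In_status_args {np} st (t u : oterm np) :
  In u (status_args st t) <-> In u (args t).
Proof.
  destruct t as [x|c|f t|f t1 t2]; simpl; try tauto.
  destruct (st f); simpl; tauto.
Qed.

(* The weight at the all-ones assignment, made total by a weight for division.  A
   quote weighs as much as its content, which agrees with [weight] on [flat] terms
   and keeps [wt1] monotone with respect to subterms. *)
Fixpoint wt1 {np} (t : oterm np) : nat :=
  match t with
  | Var _ | Cst _ => 1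
  | Un f u =>
      match f with
      | Sin | Cos => 2 ^ (wt1 u * 3)
      | Quote => wt1 u
      | Succ => wt1 u + 1
      end
  | Bin f u v =>
      match f with
      | Plus | Div => 1 + wt1 u + wt1 v
      | Times => 2 * wt1 u * wt1 v
      | Pow => (wt1 u * wt1 u) * (2 * wt1 v)
      | PwrN => (2 ^ wt1 v + 1) ^ wt1 u
      | SinN | CosN => (2 * 2 ^ (wt1 v * 3) + 1) ^ (2 * wt1 u)
      end
  end.

Lemma pow_pos a n : 1 <= a -> 1 <= a ^ n.
Proof. intros Ha. assert (a ^ n <> 0) by (apply Nat.pow_nonzero; lia). lia. Qed.

Lemma le_pow_self a n : 1 <= n -> a <= a ^ n.
Proof.
  intros Hn. destruct a as [|a]; [lia|].
  rewrite <- (Nat.pow_1_r (S a)) at 1. apply Nat.pow_le_mono_r; lia.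
Qed.

Lemma wt1_pos {np} (t : oterm np) : 1 <= wt1 t.
Proof.
  induction t as [x|c|f u IHu|f u IHu v IHv]; simpl wt1; try lia;
    destruct f; try apply pow_pos; try lia; nia.
Qed.

Lemma wt1_arg {np} (t u : oterm np) : In u (args t) -> wt1 u <= wt1 t.
Proof.
  destruct t as [x|c|f t|f t1 t2]; simpl args; try (intros []; fail).
  - intros [<-|[]]. pose proof (Nat.pow_gt_lin_r 2 (wt1 t * 3)).
    destruct f; cbn [wt1]; lia.
  - pose proof (wt1_pos t1) as H1. pose proof (wt1_pos t2) as H2.
    intros Hu. destruct f; cbn [wt1].
    4: destruct Hu as [<-|[<-|[]]]; lia.
    1-2: destruct Hu as [<-|[<-|[]]]; nia.
    + assert (1 <= wt1 t1 * wt1 t1) by nia. destruct Hu as [<-|[<-|[]]]; nia.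
    + pose proof (Nat.pow_gt_lin_r 2 (wt1 t2)).
      pose proof (le_pow_self (2 ^ wt1 t2 + 1) (wt1 t1) H1).
      pose proof (Nat.pow_gt_lin_r (2 ^ wt1 t2 + 1) (wt1 t1)).
      destruct Hu as [<-|[<-|[]]]; lia.
    + pose proof (Nat.pow_gt_lin_r 2 (wt1 t2 * 3)).
      pose proof (le_pow_self (2 * 2 ^ (wt1 t2 * 3) + 1) (2 * wt1 t1)).
      pose proof (Nat.pow_gt_lin_r (2 * 2 ^ (wt1 t2 * 3) + 1) (2 * wt1 t1)).
      destruct Hu as [<-|[<-|[]]]; lia.
    + pose proof (Nat.pow_gt_lin_r 2 (wt1 t2 * 3)).
      pose proof (le_pow_self (2 * 2 ^ (wt1 t2 * 3) + 1) (2 * wt1 t1)).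
      pose proof (Nat.pow_gt_lin_r (2 * 2 ^ (wt1 t2 * 3) + 1) (2 * wt1 t1)).
      destruct Hu as [<-|[<-|[]]]; lia.
Qed.

Lemma pow_le_mono a b m n : 1 <= a -> a <= b -> m <= n -> a ^ m <= b ^ n.
Proof.
  intros. transitivity (a ^ n);
    [apply Nat.pow_le_mono_r | apply Nat.pow_le_mono_l]; lia.
Qed.

Lemma wt1_un {np} f (u u' : oterm np) :
  wt1 u' <= wt1 u -> wt1 (Un f u') <= wt1 (Un f u).
Proof.
  intros H; destruct f; cbn [wt1]; try lia; apply pow_le_mono; lia.
Qed.

Lemma wt1_bin {np} f (u u' v v' : oterm np) :
  wt1 u' <= wt1 u -> wt1 v' <= wt1 v -> wt1 (Bin f u' v') <= wt1 (Bin f u v).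
Proof.
  intros Hu Hv.
  assert (H2 : 2 ^ (wt1 v' * 3) <= 2 ^ (wt1 v * 3)) by (apply pow_le_mono; lia).
  assert (H1 : 2 ^ wt1 v' <= 2 ^ wt1 v) by (apply pow_le_mono; lia).
  destruct f; cbn [wt1]; try lia; try (apply pow_le_mono; lia);
    repeat apply Nat.mul_le_mono; lia.
Qed.

(** * A well-founded path ordering closed under contexts *)

Definition rank {np} (t : oterm np) : nat :=
  match t with
  | Un Sin _ => np + 7
  | Un Cos _ => np + 6
  | Bin Pow _ _ => np + 5
  | Bin Times _ _ => np + 4
  | Bin Plus _ _ => np + 3
  | Cst (OPar i) => 2 + (np - proj1_sig i)
  | Un Quote _ => 1
  | _ => 0
  end.

(** A parameter has index below [np], so its rank lies between 3 and [np + 2]: above quotes, below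
    sums, and decreasing in the index. Symbols outside the precedence share rank 0 with quoted
    terms, which is harmless since [prec] never relates them. *)
Lemma prec_rank {np} (s t : oterm np) f g :
  head s = Some f -> head t = Some g -> prec f g -> rank t < rank s.
Proof.
  intros Hs Ht Hp. revert Hs Ht.
  destruct Hp as [f g i j Hf Hg Hij | i j Hij]; intros Hs Ht.
  - destruct s as [|[p|]|[]|[]]; inversion Hs; subst f; inversion Hf; subst i;
      destruct t as [|[q|]|[]|[]]; inversion Ht; subst g; inversion Hg; subst j;
      try pose proof (proj1 (Nat.ltb_lt _ _) (proj2_sig p));
      try pose proof (proj1 (Nat.ltb_lt _ _) (proj2_sig q)); simpl; lia.
  - destruct s as [|?|?|?]; simpl in Hs; try discriminate Hs; injection Hs as ->.
    destruct t as [|?|?|?]; simpl in Ht; try discriminate Ht; injection Ht as ->.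
    pose proof (proj1 (Nat.ltb_lt _ _) (proj2_sig j)); simpl; lia.
Qed.

(** Numbers replace the symbolic weights and the precedence, so division can be compared too. The
    clause [path_arg_eq] carries no weight condition because [wt1_arg] supplies it. Equal ranks
    stand in for equal heads, and the condition on tails keeps the compared argument lists of equal
    length. *)
Inductive path_gt {np} (st : binary -> direction) : oterm np -> oterm np -> Prop :=
| path_weight s t : wt1 t < wt1 s -> path_gt st s t
| path_arg_gt s t u :
    wt1 t <= wt1 s -> In u (args s) -> path_gt st u t -> path_gt st s t
| path_arg_eq s t : In t (args s) -> path_gt st s t
| path_prec s t :
    wt1 t <= wt1 s -> (forall u, In u (args t) -> path_gt st s u) ->
    rank t < rank s -> path_gt st s t
| path_lex s t l a b l1 l2 :
    wt1 t <= wt1 s -> (forall u, In u (args t) -> path_gt st s u) ->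
    rank t = rank s ->
    status_args st s = l ++ a :: l1 -> status_args st t = l ++ b :: l2 ->
    length l1 = length l2 -> path_gt st a b -> path_gt st s t.

Lemma path_gt_wt1 {np} st (s t : oterm np) : path_gt st s t -> wt1 t <= wt1 s.
Proof. destruct 1; try lia. now apply wt1_arg. Qed.

Definition list_lex {T} (lt : T -> T -> Prop) (l' l : list T) : Prop :=
  Forall (Acc lt) l' /\
  exists p a b l1 l2, l = p ++ a :: l1 /\ l' = p ++ b :: l2 /\
    length l1 = length l2 /\ lt b a.

(** Induction on the length, then on accessibility of the head, then on accessibility of the tail.
    When the head drops, the tail may become any list of the same length with accessible entries,
    which the induction on the length covers. *)
Lemma Acc_list_lex {T} (lt : T -> T -> Prop) l :
  Forall (Acc lt) l -> Acc (list_lex lt) l.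
Proof.
  remember (length l) as n eqn:Hn. revert l Hn.
  induction n as [|n IHn]; intros l Hn Hl.
  - constructor. intros l' [_ (p & a & b & l1 & l2 & -> & _)].
    rewrite length_app in Hn; simpl in Hn; lia.
  - destruct l as [|x l]; [discriminate|]. injection Hn as Hn.
    apply Forall_cons_iff in Hl as [Hx Hl].
    revert l Hn Hl. induction Hx as [x _ IHx]. intros l Hn Hl.
    assert (Htl := IHn l Hn Hl). revert Hn Hl.
    induction Htl as [l _ IHl]. intros Hn Hl.
    constructor. intros l' [Hl' (p & a & b & l1 & l2 & Hp & -> & Hlen & Hba)].
    destruct p as [|y p]; simpl in Hp; injection Hp as <- ->.
    + apply Forall_cons_iff in Hl' as [_ Hl2]. apply IHx; congruence.
    + simpl in Hl' |- *. apply Forall_cons_iff in Hl' as [_ Hl'].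
      rewrite length_app in Hn; simpl in Hn. apply IHl;
        [|rewrite length_app; simpl; lia|assumption].
      split; [assumption|]. now exists p, a, b, l1, l2.
Qed.

(** A term with accessible arguments is shown accessible by lexicographic induction on its weight,
    its rank and its list of arguments in status order; structural induction then removes the
    assumption on the arguments. *)
Lemma path_gt_wf {np} st : well_founded (fun t s : oterm np => path_gt st s t).
Proof.
  set (lt := fun t s : oterm np => path_gt st s t).
  assert (H : forall w r l, Acc (list_lex lt) l -> forall s,
    wt1 s = w -> rank s = r -> status_args st s = l ->
    Forall (Acc lt) (args s) -> Acc lt s).
  { assert (Hst : forall s,
      Forall (Acc lt) (args s) -> Forall (Acc lt) (status_args st s)).
    { intros s. rewrite !Forall_forall. intros H u Hu. apply H.
      now apply In_status_args in Hu. }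
    induction w as [w IHw] using lt_wf_ind.
    induction r as [r IHr] using lt_wf_ind.
    intros l Hl. induction Hl as [l _ IHl].
    intros s Hw Hr Hs Hargs. constructor.
    (* An inner structural induction on the smaller term: whenever its arguments are also below [s],
       they are accessible. *)
    intros t. induction t as [t IHt] using args_ind. intros Hst'.
    assert (Hsub : (forall u, In u (args t) -> path_gt st s u) ->
              Forall (Acc lt) (args t)).
    { intros H. apply Forall_forall. intros u Hu. apply IHt; [assumption|].
      now apply H. }
    (* Once the weight has dropped, rank and argument list may be arbitrary. *)
    assert (Hdrop : (forall u, In u (args t) -> path_gt st s u) ->
              wt1 t < w -> Acc lt t).
    { intros H Ht. apply (IHw (wt1 t) Ht (rank t) (status_args st t)); auto.
      apply Acc_list_lex; auto. }
    rewrite Forall_forall in Hargs.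
    inversion Hst' as [? ? Hlt|? ? u Hle Hin Hgt|? ? Hin|? ? Hle Hall Hrk
      |? ? p a b l1 l2 Hle Hall Hrk Ea Eb Hlen Hab]; subst.
    - apply Hdrop; [|assumption]. intros u Hu. apply path_weight.
      apply wt1_arg in Hu. lia.
    - exact (Acc_inv (Hargs u Hin) Hgt).
    - now apply Hargs.
    - destruct (Nat.eq_dec (wt1 t) (wt1 s)) as [E|E].
      + apply (IHr (rank t) Hrk (status_args st t)); auto.
        apply Acc_list_lex; auto.
      + apply Hdrop; [assumption|lia].
    - destruct (Nat.eq_dec (wt1 t) (wt1 s)) as [E|E].
      + apply (IHl (status_args st t)); auto. split; [auto|].
        now exists p, a, b, l1, l2.
      + apply Hdrop; [assumption|lia]. }
  intros t. induction t as [t IHt] using args_ind.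
  apply (H (wt1 t) (rank t) (status_args st t)); auto.
  - apply Acc_list_lex, Forall_forall. intros u Hu. apply IHt.
    now apply In_status_args in Hu.
  - now apply Forall_forall.
Qed.

(** Weak monotonicity of [wt1] suffices for context closure: [path_lex] carries the strict decrease,
    here and in [path_gt_bin], where the unchanged argument forms the common prefix or the tail
    according to the status. *)
Lemma path_gt_un {np} st f (u u' : oterm np) :
  path_gt st u u' -> path_gt st (Un f u) (Un f u').
Proof.
  intros H. assert (Hw := wt1_un f _ _ (path_gt_wt1 _ _ _ H)).
  apply (path_lex _ _ _ [] u u' [] []); auto.
  intros w [<-|[]]. apply (path_arg_gt _ _ _ u); simpl; auto.
  etransitivity; [|exact Hw]. apply wt1_arg. now left.
Qed.

Lemma path_gt_bin {np} st f (u u' v v' : oterm np) :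
  path_gt st u u' /\ v = v' \/ u = u' /\ path_gt st v v' ->
  path_gt st (Bin f u v) (Bin f u' v').
Proof.
  intros H.
  assert (Hw : wt1 (Bin f u' v') <= wt1 (Bin f u v)).
  { apply wt1_bin; destruct H as [[H <-]|[<- H]]; auto; now apply path_gt_wt1 in H. }
  assert (Hall : forall w, In w (args (Bin f u' v')) -> path_gt st (Bin f u v) w).
  { intros w Hin.
    assert (Hww : wt1 w <= wt1 (Bin f u v)).
    { etransitivity; [|exact Hw]. now apply wt1_arg. }
    destruct H as [[H <-]|[<- H]]; destruct Hin as [<-|[<-|[]]];
      (apply path_arg_eq; simpl; auto; fail) ||
      (eapply path_arg_gt; [exact Hww| |exact H]; simpl; auto). }
  destruct (st f) eqn:Hf; destruct H as [[H <-]|[<- H]].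
  - apply (path_lex _ _ _ [] u u' [v] [v]); simpl; rewrite ?Hf; auto.
  - apply (path_lex _ _ _ [u] v v' [] []); simpl; rewrite ?Hf; auto.
  - apply (path_lex _ _ _ [v] u u' [] []); simpl; rewrite ?Hf; auto.
  - apply (path_lex _ _ _ [] v v' [u] [u]); simpl; rewrite ?Hf; auto.
Qed.

(** * Shapes, and the embedding of the weighted path ordering *)

Fixpoint collapse {np} (t : oterm np) : oterm np :=
  match t with
  | Var x => Var x
  | Cst (OTerm _) => Cst (OTerm (Var 0))
  | Cst c => Cst c
  | Un f u => Un f (collapse u)
  | Bin f u v => Bin f (collapse u) (collapse v)
  end.

Definition shape {np} (t : term np) : oterm np := collapse (to_oterm t).

Lemma args_collapse {np} (t : oterm np) : args (collapse t) = map collapse (args t).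
Proof. now destruct t as [|[]|[]|[]]. Qed.

Lemma status_args_collapse {np} st (t : oterm np) :
  status_args st (collapse t) = map collapse (status_args st t).
Proof.
  destruct t as [|[]|[]|f ? ?]; try reflexivity. simpl. now destruct (st f).
Qed.

Lemma rank_collapse {np} (t : oterm np) : rank (collapse t) = rank t.
Proof. now destruct t as [|[]|[]|[]]. Qed.

Lemma wt1_collapse {np} (t : oterm np) : wt1 (collapse t) = wt1 t.
Proof.
  induction t as [|[]|f u IHu|f u IHu v IHv]; simpl collapse; cbn [wt1];
    rewrite ?IHu, ?IHv; reflexivity.
Qed.

(* Terms whose quotes contain only constants, such as the image of [to_oterm]; only
   there does [wt1] agree with [weight]. *)
Fixpoint flat {np} (t : oterm np) : Prop :=
  match t with
  | Var _ | Cst _ => True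
  | Un Quote u => exists c, u = Cst c
  | Un _ u => flat u
  | Bin _ u v => flat u /\ flat v
  end.

Lemma flat_arg {np} (t u : oterm np) : flat t -> In u (args t) -> flat u.
Proof.
  destruct t as [|?|f t|f t1 t2]; simpl; try tauto.
  - intros H [<-|[]]. destruct f; auto. now destruct H as [c ->].
  - now intros [H1 H2] [<-|[<-|[]]].
Qed.

Lemma flat_to_oterm {np} (t : term np) : flat (to_oterm t).
Proof. induction t as [|[]|[] ? ?|[] ? ? ? ?]; simpl; eauto. Qed.

Lemma weight_wt1 {np} (t : oterm np) m :
  flat t -> weight (fun _ => 1) t = Some m -> wt1 t = m.
Proof.
  revert m. induction t as [x|c|f u IHu|f u IHu v IHv]; intros m Ht Hm.
  - now injection Hm.
  - now injection Hm.
  - cbn [weight] in Hm. destruct f; cbn [wt1]; cbn [flat] in Ht.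
    3: destruct Ht as [c ->]; now injection Hm.
    all: destruct (weight _ u) as [k|]; try discriminate Hm;
      injection Hm as <-; rewrite (IHu k); auto.
  - destruct Ht as [Hu Hv]. cbn [weight] in Hm.
    destruct f; try discriminate Hm; cbn [wt1];
      destruct (weight _ u) as [k|]; try discriminate Hm;
      destruct (weight _ v) as [k'|]; try discriminate Hm;
      injection Hm as <-; rewrite (IHu k), (IHv k'); auto.
Qed.

Lemma weight_ge_wt1 {np} (s t : oterm np) :
  flat s -> flat t -> weight_ge s t -> wt1 t <= wt1 s.
Proof.
  intros Hs Ht H.
  destruct (H (fun _ => 1)) as (m & k & Hm & Hk & Hkm); [lia|].
  now rewrite (weight_wt1 s m), (weight_wt1 t k).
Qed.

Lemma weight_gt_wt1 {np} (s t : oterm np) :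
  flat s -> flat t -> weight_gt s t -> wt1 t < wt1 s.
Proof.
  intros Hs Ht H.
  destruct (H (fun _ => 1)) as (m & k & Hm & Hk & Hkm); [lia|].
  now rewrite (weight_wt1 s m), (weight_wt1 t k).
Qed.

Lemma head_rank {np} (s t : oterm np) f :
  head s = Some f -> head t = Some f -> rank t = rank s.
Proof.
  intros Hs Ht. rewrite <- Hs in Ht.
  destruct s as [|?|?|?], t as [|?|?|?]; inversion Ht; reflexivity.
Qed.

Lemma head_length {np} st (s t : oterm np) f :
  head s = Some f -> head t = Some f ->
  length (status_args st s) = length (status_args st t).
Proof.
  intros Hs Ht. rewrite <- Hs in Ht.
  destruct s as [|?|?|g ? ?], t as [|?|?|h ? ?]; inversion Ht; try reflexivity.
  simpl. now destruct (st g).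
Qed.

(** Collapsing keeps weights, ranks and argument positions, and no clause of [wpo] needs two quoted
    terms to be different. Weight conditions are used at the all-ones assignment only; flatness
    makes [weight] and [wt1] agree there. *)
Lemma wpo_collapse {np} st (s t : oterm np) :
  wpo st s t -> flat s -> flat t -> path_gt st (collapse s) (collapse t).
Proof.
  induction 1 as [s t Hw|s t u Hw Hin _ IH|s t Hw Hin|s t f g Hw Hf Hg _ IH Hp
    |s t f l a b l1 l2 Hw Hf Hg Hgt IH Ea Eb _ IHab]; intros Hs Ht.
  - apply path_weight. rewrite !wt1_collapse. now apply weight_gt_wt1.
  - apply (path_arg_gt _ _ _ (collapse u)).
    + rewrite !wt1_collapse. now apply weight_ge_wt1.
    + rewrite args_collapse. now apply in_map.
    + apply IH; [now apply (flat_arg s)|assumption].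
  - apply path_arg_eq. rewrite args_collapse. now apply in_map.
  - apply path_prec.
    + rewrite !wt1_collapse. now apply weight_ge_wt1.
    + rewrite args_collapse. intros v [u [<- Hu]]%in_map_iff.
      apply IH; auto. now apply (flat_arg t).
    + rewrite !rank_collapse. now apply (prec_rank s t f g).
  - apply (path_lex _ _ _ (map collapse l) (collapse a) (collapse b)
             (map collapse l1) (map collapse l2)).
    + rewrite !wt1_collapse. now apply weight_ge_wt1.
    + rewrite args_collapse. intros v [u [<- Hu]]%in_map_iff.
      apply IH; auto. now apply (flat_arg t).
    + rewrite !rank_collapse. now apply (head_rank s t f).
    + rewrite status_args_collapse, Ea. now rewrite map_app.
    + rewrite status_args_collapse, Eb. now rewrite map_app.
    + rewrite !length_map. assert (E := head_length st s t f Hf Hg).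
      rewrite Ea, Eb, !length_app in E. simpl in E. lia.
    + apply IHab.
      * apply (flat_arg s); [assumption|]. apply (In_status_args st). rewrite Ea.
        apply in_elt.
      * apply (flat_arg t); [assumption|]. apply (In_status_args st). rewrite Eb.
        apply in_elt.
Qed.

Lemma succ_ord_shape {np} st (s t : term np) :
  succ_ord st s t -> path_gt st (shape s) (shape t).
Proof. intros H. apply wpo_collapse; auto using flat_to_oterm. Qed.

(** * A strictly monotone interpretation *)

(** Sum and product are interpreted by associative commutative operations, and the factor 2 makes
    distributivity strict. A cube in [Pow] is needed for [(x * y) ^ a]: a square would only give
    equality. Base 8 exceeds the total 7 produced by the addition formula for the cosine, and
    [4 * 8 ^ m + 3] absorbs the recurrences for [CosN] and [SinN]. *)
Fixpoint mass {np} (t : oterm np) : nat :=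
  match t with
  | Var _ | Cst _ => 1
  | Un f u =>
      match f with
      | Sin | Cos => 8 ^ mass u
      | Quote => mass u
      | Succ => 1 + mass u
      end
  | Bin f u v =>
      match f with
      | Plus | Div => 1 + mass u + mass v
      | Times => 2 * mass u * mass v
      | Pow => 2 * mass u ^ 3 * mass v
      | PwrN => (2 * mass u + 1) ^ mass v
      | SinN | CosN => (4 * 8 ^ mass v + 3) ^ mass u
      end
  end.

Lemma mass_pos {np} (t : oterm np) : 1 <= mass t.
Proof.
  induction t as [x|c|f u IHu|f u IHu v IHv]; cbn [mass]; try lia;
    destruct f; try (apply pow_pos; lia); try lia.
  pose proof (pow_pos (mass u) 3 IHu). nia.
Qed.

Lemma mass_un {np} f (u u' : oterm np) :
  mass u' < mass u -> mass (Un f u') < mass (Un f u).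
Proof.
  intros H; destruct f; cbn [mass]; try lia; apply Nat.pow_lt_mono_r; lia.
Qed.

Lemma mass_bin_l {np} f (u u' v : oterm np) :
  mass u' < mass u -> mass (Bin f u' v) < mass (Bin f u v).
Proof.
  pose proof (mass_pos v) as Hv.
  intros H; destruct f; cbn [mass]; try lia.
  - nia.
  - pose proof (Nat.pow_lt_mono_l (mass u') (mass u) 3). nia.
  - apply Nat.pow_lt_mono_l; lia.
  - apply Nat.pow_lt_mono_r; lia.
  - apply Nat.pow_lt_mono_r; lia.
Qed.

Lemma mass_bin_r {np} f (u v v' : oterm np) :
  mass v' < mass v -> mass (Bin f u v') < mass (Bin f u v).
Proof.
  pose proof (mass_pos u) as Hu.
  intros H; destruct f; cbn [mass]; try lia.
  - nia.
  - pose proof (pow_pos (mass u) 3 Hu). nia.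
  - apply Nat.pow_lt_mono_r; lia.
  - assert (8 ^ mass v' < 8 ^ mass v) by (apply Nat.pow_lt_mono_r; lia).
    apply Nat.pow_lt_mono_l; lia.
  - assert (8 ^ mass v' < 8 ^ mass v) by (apply Nat.pow_lt_mono_r; lia).
    apply Nat.pow_lt_mono_l; lia.
Qed.

Definition shape_gt {np} st (s t : oterm np) : Prop :=
  mass t < mass s \/ mass t = mass s /\ path_gt st s t.

Lemma shape_gt_wf {np} st : well_founded (fun t s : oterm np => shape_gt st s t).
Proof.
  intros s. remember (mass s) as m eqn:Hm. revert s Hm.
  induction m as [m IHm] using lt_wf_ind.
  intros s. induction (path_gt_wf st s) as [s _ IHs]. intros ->.
  constructor. intros t [Ht|[Ht Hgt]].
  - now apply (IHm (mass t)).
  - now apply IHs.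
Qed.

Lemma shape_gt_un {np} st f (u u' : oterm np) :
  shape_gt st u u' -> shape_gt st (Un f u) (Un f u').
Proof.
  intros [H|[E H]].
  - left. now apply mass_un.
  - right. split; [|now apply path_gt_un]. cbn [mass]. now rewrite E.
Qed.

Lemma shape_gt_bin_l {np} st f (u u' v : oterm np) :
  shape_gt st u u' -> shape_gt st (Bin f u v) (Bin f u' v).
Proof.
  intros [H|[E H]].
  - left. now apply mass_bin_l.
  - right. split; [|apply path_gt_bin; auto]. cbn [mass]. now rewrite E.
Qed.

Lemma shape_gt_bin_r {np} st f (u v v' : oterm np) :
  shape_gt st v v' -> shape_gt st (Bin f u v) (Bin f u v').
Proof.
  intros [H|[E H]].
  - left. now apply mass_bin_r.
  - right. split; [|apply path_gt_bin; auto]. cbn [mass]. now rewrite E.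
Qed.

(** * Quoted terms and rewriting in context *)

Fixpoint quoted {C} (t : tm C) : list (tm C) :=
  match t with
  | Var _ | Cst _ => []
  | Un Quote u => [u]
  | Un _ u => quoted u
  | Bin _ u v => quoted u ++ quoted v
  end.

Lemma shape_normalize {np} simp (t : term np) : shape (normalize simp t) = shape t.
Proof.
  unfold shape. induction t as [|[]|f u IH|f u IHu v IHv]; try reflexivity.
  - destruct f; try reflexivity; simpl; congruence.
  - simpl; congruence.
Qed.

Lemma quoted_normalize {np} simp (t : term np) :
  quoted (normalize simp t) = map simp (quoted t).
Proof.
  induction t as [|[]|f u IH|f u IHu v IHv]; try reflexivity.
  - destruct f; try reflexivity; exact IH.
  - simpl. rewrite IHu, IHv. symmetry. apply map_app.
Qed.

Lemma quotes_pure_quoted {np} (t : term np) :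
  quotes_pure t = true -> Forall (fun u => pure u = true) (quoted t).
Proof.
  induction t as [|?|f u IH|f u IHu v IHv]; simpl; auto.
  - destruct f; auto.
  - intros [Hu Hv]%andb_prop. apply Forall_app; auto.
Qed.

Lemma quote_free_quoted {C} (t : tm C) : quote_free t = true -> quoted t = [].
Proof.
  induction t as [|?|f u IH|f u IHu v IHv]; simpl; auto.
  - destruct f; auto; discriminate.
  - intros [Hu Hv]%andb_prop. now rewrite IHu, IHv.
Qed.

(** An inductive substitute for positions. The case [closure_un] includes [Quote], since redexes
    below quotes are allowed. *)
Inductive closure {C} (root : tm C -> tm C -> Prop) : tm C -> tm C -> Prop :=
| closure_root t t' : root t t' -> closure root t t'
| closure_un f u u' : closure root u u' -> closure root (Un f u) (Un f u')
| closure_left f u u' v :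
    closure root u u' -> closure root (Bin f u v) (Bin f u' v)
| closure_right f u v v' :
    closure root v v' -> closure root (Bin f u v) (Bin f u v').

Definition root_step {np} (simp : term np -> term np) st (sys : list (rule np))
    (t t' : term np) : Prop :=
  exists rho d, In rho sys /\ t = subst d (lhs rho) /\
    guard_holds st d (guard rho) /\
    quotes_pure (subst d (rhs rho)) = true /\
    t' = normalize simp (subst d (rhs rho)).

Lemma closure_replace_at {C} (root : tm C -> tm C -> Prop) p (t u s : tm C) :
  subterm_at t p = Some u -> root u s -> closure root t (replace_at t p s).
Proof.
  revert t. induction p as [|i p IH]; intros t Hu Hs.
  - injection Hu as <-. destruct t; now apply closure_root.
  - destruct t as [x|c|f t|f t1 t2], i as [|[|[|]]]; simpl in Hu |- *;
      try discriminate Hu.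
    + apply closure_un; auto.
    + apply closure_left; auto.
    + apply closure_right; auto.
Qed.

Lemma rewrite_step_closure {np} simp st sys (t t' : term np) :
  rewrite_step simp st sys t t' -> closure (root_step simp st sys) t t'.
Proof.
  intros (rho & Hin & p & u & d & Hp & _ & Hu & Hg & Hq & ->).
  apply (closure_replace_at _ _ _ u); [assumption|].
  exists rho, d. auto.
Qed.

Definition list_step {T} (step : T -> T -> Prop) (l l' : list T) : Prop :=
  exists l1 u u' l2, l = l1 ++ u :: l2 /\ l' = l1 ++ u' :: l2 /\ step u u'.

(** A step acts either on the head or within the tail, so nested induction on their two
    accessibilities suffices. *)
Lemma Acc_list_step {T} (step : T -> T -> Prop) l :
  Forall (Acc (fun u' u => step u u')) l -> Acc (fun l' l => list_step step l l') l.
Proof.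
  induction 1 as [|x l Hx _ IHl].
  - constructor. intros l' ([|] & u & u' & l2 & E & _); discriminate E.
  - revert l IHl. induction Hx as [x _ IHx]. intros l Hl.
    induction (Hl) as [l Hacc IHl].
    constructor. intros l' ([|y l1] & u & u' & l2 & E & -> & Hu);
      simpl in E |- *; injection E as <- ->.
    + now apply IHx.
    + assert (Hs : list_step step (l1 ++ u :: l2) (l1 ++ u' :: l2)).
      { now exists l1, u, u', l2. }
      now apply IHl; [|apply Hacc].
Qed.

Lemma closure_quoted {C} (root : tm C -> tm C -> Prop) (P : tm C -> Prop) t t' :
  (forall u u', root u u' -> Forall P (quoted u) -> Forall P (quoted u')) ->
  (forall u u', closure root u u' -> P u -> P u') ->
  closure root t t' -> Forall P (quoted t) -> Forall P (quoted t').
Proof.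
  intros Hroot Hin. induction 1 as [t t' H|f u u' H IH|f u u' v H IH|f u v v' H IH]; simpl.
  - now apply Hroot.
  - destruct f; auto. intros Hu. inversion_clear Hu. constructor; eauto.
  - intros [Hu Hv]%Forall_app. apply Forall_app; auto.
  - intros [Hu Hv]%Forall_app. apply Forall_app; auto.
Qed.

Definition root_oriented {np} st (root : term np -> term np -> Prop) : Prop :=
  forall t t', root t t' -> shape_gt st (shape t) (shape t').

(** The two alternatives are a redex outside all quotes and a redex inside an outermost one. *)
Lemma closure_cases {np} st root (t t' : term np) :
  root_oriented st root -> closure root t t' ->
  shape_gt st (shape t) (shape t') \/
  shape t' = shape t /\ list_step (closure root) (quoted t) (quoted t').
Proof.
  intros Hroot. unfold shape.
  induction 1 as [t t' H|f u u' H IH|f u u' v H IH|f u v v' H IH].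
  - left. now apply Hroot.
  - destruct f.
    3: right; split; [reflexivity|]; now exists [], u, u', [].
    all: simpl; destruct IH as [IH|[E IH]];
      [left; now apply shape_gt_un | right; split; [congruence|assumption]].
  - simpl. destruct IH as [IH|[E (l1 & w & w' & l2 & E1 & E2 & Hw)]];
      [left; now apply shape_gt_bin_l|right].
    split; [congruence|]. exists l1, w, w', (l2 ++ quoted v).
    rewrite E1, E2, <- !app_assoc. auto.
  - simpl. destruct IH as [IH|[E (l1 & w & w' & l2 & E1 & E2 & Hw)]];
      [left; now apply shape_gt_bin_r|right].
    split; [congruence|]. exists (quoted u ++ l1), w, w', l2.
    rewrite E1, E2, !app_assoc. auto.
Qed.

(** Lexicographic induction on the shape and then on the list of quoted terms. A decrease in shape
    may change that list arbitrarily; the invariant [P] guarantees that the new list is accessible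
    again. *)
Lemma Acc_of_quoted {np} st (root : term np -> term np -> Prop) (P : term np -> Prop) t :
  root_oriented st root ->
  (forall u, P u -> Acc (fun t' t => closure root t t') u) ->
  (forall u u', root u u' -> Forall P (quoted u) -> Forall P (quoted u')) ->
  (forall u u', closure root u u' -> P u -> P u') ->
  Forall P (quoted t) -> Acc (fun t' t => closure root t t') t.
Proof.
  intros Hor Hacc Hroot Hcl.
  assert (Hlist : forall t, Forall P (quoted t) ->
            Acc (fun l' l => list_step (closure root) l l') (quoted t)).
  { intros u Hu. apply Acc_list_step. now apply (Forall_impl _ Hacc). }
  remember (shape t) as s eqn:Hs. revert t Hs.
  induction (shape_gt_wf st s) as [s _ IHs]. intros t Hs Ht.
  assert (Hl := Hlist t Ht). remember (quoted t) as l eqn:El.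
  revert t El Hs Ht. induction Hl as [l _ IHl]. intros t -> -> Ht.
  constructor. intros t' Hstep.
  assert (Ht' : Forall P (quoted t')) by now apply (closure_quoted root P t t').
  destruct (closure_cases st root t t' Hor Hstep) as [H|[E H]].
  - now apply (IHs (shape t')).
  - now apply (IHl (quoted t')).
Qed.

(** * A termination criterion for rule systems *)

Definition is_const {C} (t : tm C) : Prop :=
  match t with Cst _ => True | _ => False end.

Definition is_app {C} (t : tm C) : Prop :=
  match t with Un _ _ | Bin _ _ _ => True | _ => False end.

(** [good_app] makes constants irreducible. [good_ground] ensures that constant quoted terms give
    rise only to ground ones, which [simp] turns into literals. *)
Record good_rule {np} st (rho : rule np) : Prop := {
  good_app : is_app (lhs rho);
  good_oriented : forall d, guard_holds st d (guard rho) ->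
    shape_gt st (shape (subst d (lhs rho))) (shape (subst d (rhs rho)));
  good_ground : forall d,
    Forall (fun u => ground u = true) (quoted (subst d (lhs rho))) ->
    Forall (fun u => ground u = true) (quoted (subst d (rhs rho)))
}.

Lemma terminating_of_good {np} (A : algebra np) simp st (sys : list (rule np)) :
  simplifier A simp -> Forall (good_rule st) sys ->
  terminating (rewrite_step simp st sys).
Proof.
  intros Hsimp Hsys. rewrite Forall_forall in Hsys.
  set (root := root_step simp st sys).
  assert (Hor : root_oriented st root).
  { intros t t' (rho & d & Hin & -> & Hg & _ & ->). rewrite shape_normalize.
    now apply good_oriented; [apply Hsys|]. }
  assert (Hirr : forall u u', closure root u u' -> is_const u -> False).
  { intros u u' [t t' (rho & d & Hin & -> & _)| | |]; simpl; try tauto.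
    assert (H := good_app _ _ (Hsys rho Hin)). now destruct (lhs rho). }
  assert (Hconst : forall t, Forall is_const (quoted t) ->
            Acc (fun t' t => closure root t t') t).
  { intros t. apply (Acc_of_quoted st root is_const); auto.
    - intros u Hu. constructor. intros u' H. now destruct (Hirr u u').
    - intros u u' (rho & d & Hin & -> & _ & Hq & ->) Hu.
      rewrite quoted_normalize. apply Forall_map.
      apply quotes_pure_quoted in Hq.
      apply (Forall_impl (fun w => ground w = true)) in Hu; [|now intros []].
      apply (good_ground _ _ (Hsys rho Hin)) in Hu.
      rewrite Forall_forall in *. intros w Hw.
      destruct (simp_ground Hsimp (Hq w Hw) (Hu w Hw)) as [c ->]. exact I.
    - intros u u' H Hu. now destruct (Hirr u u'). }
  (* The invariant is now accessibility itself. After a root step every quoted term is a value of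
     [simp] on a pure term, hence quote-free, so [Hconst] applies to it vacuously. *)
  assert (Hall : forall t, Forall (Acc (fun t' t => closure root t t')) (quoted t) ->
            Acc (fun t' t => closure root t t') t).
  { intros t. apply (Acc_of_quoted st root _ t Hor); auto.
    - intros u u' (rho & d & Hin & -> & _ & Hq & ->) _.
      rewrite quoted_normalize. apply Forall_map.
      apply quotes_pure_quoted in Hq. revert Hq. apply Forall_impl.
      intros w Hw. apply Hconst.
      apply (simp_pure Hsimp), andb_prop in Hw as [Hw _].
      now rewrite quote_free_quoted.
    - intros u u' H Hu. exact (Acc_inv Hu H). }
  (* At a quote, the induction hypothesis covers the quoted terms of its content, and [Hall] makes
     the content accessible. *)
  assert (Hquoted : forall t, Forall (Acc (fun t' t => closure root t t')) (quoted t)).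
  { induction t as [x|c|f u IH|f u IHu v IHv]; simpl; auto.
    - destruct f; auto.
    - apply Forall_app; auto. }
  intros t (f & <- & Hf). generalize (Hall _ (Hquoted (f 0))).
  generalize 0. intros n Hn. remember (f n) as s eqn:Hs. revert n Hs.
  induction Hn as [s _ IH]. intros n ->.
  apply (IH (f (S n))) with (n := S n); [|reflexivity].
  apply rewrite_step_closure, Hf.
Qed.

(** * Orientation of the rules *)

Definition is_ac (f : binary) : Prop := f = Plus \/ f = Times.

Lemma shape_gt_comm {np} st f (x y : oterm np) :
  is_ac f -> st f = LeftToRight -> path_gt st x y ->
  shape_gt st (Bin f x y) (Bin f y x).
Proof.
  intros Hf Hst H. right. split.
  - destruct Hf as [-> | ->]; cbn [mass]; lia.
  - apply (path_lex _ _ _ [] x y [y] [x]); simpl status_args; rewrite ?Hst; auto.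
    + destruct Hf as [-> | ->]; cbn [wt1]; lia.
    + intros u [<-|[<-|[]]]; apply path_arg_eq; simpl; auto.
Qed.

(** The first arguments decide the lexicographic comparison. Both arguments of the right side are
    strictly lighter than the left side, since all weights are positive. *)
Lemma shape_gt_left_comm {np} st f (x y z : oterm np) :
  is_ac f -> st f = LeftToRight -> path_gt st x y ->
  shape_gt st (Bin f x (Bin f y z)) (Bin f y (Bin f x z)).
Proof.
  intros Hf Hst H.
  pose proof (wt1_pos x). pose proof (wt1_pos y). pose proof (wt1_pos z).
  assert (1 <= wt1 x * wt1 z) by nia.
  right. split.
  - destruct Hf as [-> | ->]; cbn [mass]; lia.
  - apply (path_lex _ _ _ [] x y [Bin f y z] [Bin f x z]);
      simpl status_args; rewrite ?Hst; auto.
    + destruct Hf as [-> | ->]; cbn [wt1]; lia.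
    + intros u [<-|[<-|[]]]; apply path_weight;
        destruct Hf as [-> | ->]; cbn [wt1]; nia.
Qed.

Lemma shape_gt_assoc {np} st f (x y z : oterm np) :
  is_ac f -> st f = LeftToRight ->
  shape_gt st (Bin f (Bin f x y) z) (Bin f x (Bin f y z)).
Proof.
  intros Hf Hst.
  pose proof (wt1_pos x). pose proof (wt1_pos y). pose proof (wt1_pos z).
  assert (1 <= wt1 y * wt1 z) by nia.
  right. split.
  - destruct Hf as [-> | ->]; cbn [mass]; lia.
  - apply (path_lex _ _ _ [] (Bin f x y) x [z] [Bin f y z]);
      simpl status_args; rewrite ?Hst; auto.
    + destruct Hf as [-> | ->]; cbn [wt1]; lia.
    + intros u [<-|[<-|[]]]; apply path_weight;
        destruct Hf as [-> | ->]; cbn [wt1]; nia.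
    + apply path_arg_eq. now left.
Qed.

Ltac solve_ground :=
  cbn [subst lhs rhs quoted app]; 
  repeat rewrite ?Forall_app, ?Forall_cons_iff; cbn [ground];
  rewrite ?Bool.andb_true_iff; intuition auto.

Ltac unfold_shape :=
  unfold shape; cbn [subst lhs rhs to_oterm collapse].

Ltac solve_ac :=
  unfold_shape;
  first [apply shape_gt_comm | apply shape_gt_left_comm | apply shape_gt_assoc];
  [(now left) || (now right) | reflexivity | apply succ_ord_shape; assumption ..].

Ltac unfold_mass d :=
  left; unfold_shape; cbn [mass];
  repeat match goal with
  | |- context [mass (collapse (to_oterm (d ?i)))] =>
      let m := fresh "m" in
      pose proof (mass_pos (collapse (to_oterm (d i))));
      set (m := mass (collapse (to_oterm (d i)))) in *; clearbody m
  end.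

Lemma good_arithmetic_rules np : Forall (good_rule canon_status) (arithmetic_rules np).
Proof.
  unfold arithmetic_rules.
  repeat apply Forall_cons; try apply Forall_nil.
  all: split; [exact I|intros d H|intros d; solve_ground].
  all: try (solve_ac; fail); clear H; unfold_mass d.
  all: try nia.
  all: try (pose proof (pow_pos m 3 H) as Hp; set (p := m ^ 3) in *).
  (* For [(x ^ y) ^ z], with [q] the mass of [x ^ y], the claim reduces to [q < q ^ 3]. *)
  - set (q := 2 * p * m0). assert (2 <= q) by (unfold q; nia).
    assert (q < q ^ 3) by (cbn [Nat.pow]; nia). unfold q in *. nia.
  (* The bound on the sum is [(m0 - 1) * (m1 - 1) >= 0] expanded. *)
  - assert (1 <= m0 * m1) by nia. assert (m0 + m1 <= 1 + m0 * m1) by nia. nia.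
  - assert (1 <= m0 * m1) by nia. assert (m0 + m1 <= 1 + m0 * m1) by nia.
    assert (1 + m0 + m1 < 4 * p * (m0 * m1)) by nia. nia.
  - simpl. lia.
  - rewrite Nat.pow_1_r. lia.
  - pose proof (pow_pos (2 * m + 1) m0). cbn [Nat.pow Nat.add]. nia.
  - pose proof (le_pow_self (1 + m + m0) 3). lia.
  (* The cube of the factor 2 gives coefficient 16 on the left, against 8 on the right. *)
  - rewrite !Nat.pow_mul_l. pose proof (pow_pos m0 3 H0).
    change (2 ^ 3) with 8. fold p. nia.
  - lia.
Qed.

Lemma good_trigonometric_rules np :
  Forall (good_rule canon_status) (trigonometric_rules np).
Proof.
  unfold trigonometric_rules.
  repeat apply Forall_cons; try apply Forall_nil.
  all: split; [exact I|intros d _|intros d; solve_ground]; unfold_mass d.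
  all: pose proof (le_pow_self 8 m H).
  all: try (replace (2 * 1 * m) with (m + m) by lia).
  all: rewrite ?Nat.pow_add_r, ?Nat.pow_1_r.
  - nia.
  - nia.
  - assert (1 <= 8 ^ m * 8 ^ m0) by (rewrite <- Nat.pow_add_r; apply pow_pos; lia).
    lia.
  (* With [P] for this product, the claim is [1 + 6 * P < 8 * P]. *)
  - assert (1 <= 8 ^ m * 8 ^ m0) by (rewrite <- Nat.pow_add_r; apply pow_pos; lia).
    lia.
  (* Since [K * K ^ (m0 + 1)] splits as [4 * 8 ^ m * K ^ (m0 + 1) + 3 * K ^ (m0 + 1)], what remains
     is [1 + 2 * K ^ m0 < 3 * K ^ (m0 + 1)]. *)
  - set (K := 4 * 8 ^ m + 3). assert (1 <= K ^ m0) by (apply pow_pos; lia). nia.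
  - set (K := 4 * 8 ^ m + 3). assert (1 <= K ^ m0) by (apply pow_pos; lia). nia.
Qed.

Lemma good_evaluation_rules np :
  Forall (good_rule canon_status) (evaluation_rules np).
Proof.
  unfold evaluation_rules.
  repeat apply Forall_cons; try apply Forall_nil.
  all: split; [exact I|intros d _|intros d; solve_ground]; unfold_mass d.
  all: try (pose proof (le_pow_self 8 m H)).
  all: try (replace (2 * 1 * m) with (m + m) by lia).
  all: rewrite ?Nat.pow_add_r, ?Nat.pow_1_r; nia.
Qed.

Lemma good_simp_system np : Forall (good_rule simp_status) (simp_system np).
Proof.
  unfold simp_system.
  repeat apply Forall_cons; try apply Forall_nil.
  all: split; [exact I|intros d H|intros d; solve_ground].
  (* The two coefficients have the same shape, so the products differ only in their second factors,
     which the guard compares. *)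
  - unfold_shape. apply shape_gt_comm; [now left|reflexivity|].
    apply path_gt_bin. right. split; [reflexivity|]. now apply succ_ord_shape.
  - unfold_shape. apply shape_gt_left_comm; [now left|reflexivity|].
    apply path_gt_bin. right. split; [reflexivity|]. now apply succ_ord_shape.
  - unfold_mass d. lia.
  - unfold_mass d. lia.
Qed.

Theorem theorem6 (np : nat) (A : algebra np) (simp : term np -> term np)
    (hA : real_algebra A) (hsimp : simplifier A simp) :
  terminating (rewrite_step simp canon_status (canon_without_sin_square np)) /\
  terminating (rewrite_step simp simp_status (simp_system np)).
Proof.
  split; apply (terminating_of_good A); auto using good_simp_system.
  unfold canon_without_sin_square. rewrite !Forall_app.
  auto using good_arithmetic_rules, good_trigonometric_rules, good_evaluation_rules.
Qed.
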